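(* Let $r\ge 1$, let $\mathfrak{g}=\mathfrak{sp}_r(\mathbb{C})$ and let $\mathfrak{k}$ be the fix-point Lie subalgebra of $\mathfrak{sp}_r(\mathbb{C})$ with respect to the Chevalley involution $\omega(X)=-X^T$. For $t\in\mathbb{C}$ let $\chi_t$ be the one-dimensional representation of $\mathfrak{k}$ with $\chi_t(Y_i)=0$ for $1\le i<r$ and $\chi_t(Y_r)=t$. Then for $\alpha\in\Phi_+$, $$\chi_t(y_\alpha)=\begin{cases}0&\text{if }\alpha\in\Phi^s_+,\\ t&\text{if }\alpha\in\Phi^\ell_+.\end{cases}$$
   Context: $\mathfrak{sp}_r(\mathbb{C})$ is the Lie algebra of complex $2r\times2r$ matrices $\begin{pmatrix} B & C \\ D & -B^T \end{pmatrix}$ with $B,C,D\in\mathfrak{gl}_r(\mathbb{C})$, $C^T=C$, $D^T=D$. Thus $\mathfrak{k}=\left\{\begin{pmatrix} B & C \\ -C & B \end{pmatrix}\mid B^T=-B,\ C^T=C\right\}$. Let $E_{k,\ell}$ be the matrix units of $\mathfrak{gl}_r(\mathbb{C})$, $\mathfrak{h}$ the diagonal matrices in $\mathfrak{sp}_r(\mathbb{C})$, and $\epsilon_j\in\mathfrak{h}^*$ given by $\epsilon_j\begin{pmatrix} E_{k,k} & 0 \\ 0 & -E_{k,k} \end{pmatrix}=\delta_{j,k}$. The root system is $\Phi=\{\pm(\epsilon_k\pm\epsilon_\ell)\}_{k\ne\ell}\cup\{\pm2\epsilon_j\}_{j=1}^r$, with simple roots $\alpha_k=\epsilon_k-\epsilon_{k+1}$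 ($1\le k<r$), $\alpha_r=2\epsilon_r$. The short and long positive roots are $\Phi^s_+=\{\epsilon_j\pm\epsilon_k\mid1\le j<k\le r\}$ and $\Phi^\ell_+=\{2\epsilon_\ell\mid1\le\ell\le r\}$ (for $r=1$, all roots are regarded as long), and $\Phi_+=\Phi^s_+\cup\Phi^\ell_+$. Root vectors, for $1\le k\ne\ell\le r$ and $1\le j\le r$: $$e_{\epsilon_k-\epsilon_\ell}=\begin{pmatrix} E_{k,\ell} & 0 \\ 0 & -E_{\ell,k} \end{pmatrix},\quad e_{\epsilon_k+\epsilon_\ell}=\begin{pmatrix} 0 & E_{k,\ell}+E_{\ell,k} \\ 0 & 0 \end{pmatrix},\quad e_{-\epsilon_k-\epsilon_\ell}=\begin{pmatrix} 0 & 0 \\ E_{k,\ell}+E_{\ell,k} & 0 \end{pmatrix},$$ $$e_{2\epsilon_j}=\begin{pmatrix} 0 & E_{j,j} \\ 0 & 0 \end{pmatrix},\quad e_{-2\epsilon_j}=\begin{pmatrix} 0 & 0 \\ E_{j,j} & 0 \end{pmatrix}.$$ Put $y_\alpha:=e_\alpha-e_{-\alpha}\in\mathfrak{k}$ for $\alpha\in\Phi$ and $Y_j:=y_{\alpha_j}$ for $1\le j\le r$; the $Y_j$ generate $\mathfrak{k}$. A one-dimensional representation of $\mathfrak{k}$ is a linear functional on $\mathfrak{k}$ vanishing on $[\mathfrak{k},\mathfrak{k}]$; for each $t\in\mathbb{C}$ the representation $\chi_t$ exists and is unique, and these are all the one-dimensional representations of $\mathfrak{k}$. *)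

(* Defs.v *)
From HB Require Import structures.
From mathcomp Require Import all_boot all_order all_algebra.
From mathcomp Require Import ring zify.
From mathcomp Require Export reals complex.

Set Implicit Arguments.
Unset Strict Implicit.
Unset Printing Implicit Defensive.

Import Order.TTheory GRing.Theory Num.Theory.

Local Open Scope ring_scope.

(* The field of complex numbers is R[i] for R : realType.  Indices are      *)
(* 0-based: j : 'I_r stands for the index j + 1 of the usual numbering.     *)

Section SymplecticLieAlgebra.

Variables (R : realType) (r : nat).

Local Notation C := R[i].
Local Notation M := 'M[C]_(r + r).

(* The kernel of sp_defect is the set of matrices block_mx B C D (- B^T)    *)
(* with C and D symmetric, see spP.                                         *)
Definition sp_defect (X : M) : 'M[C]_r * 'M[C]_r * 'M[C]_r :=
  ((ursubmx X)^T - ursubmx X, (dlsubmx X)^T - dlsubmx X,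
   drsubmx X + (ulsubmx X)^T).

Fact sp_defect_is_linear : linear sp_defect.
Proof.
move=> a X Y; rewrite /sp_defect.
by congr (_, _, _); apply/matrixP => i j; rewrite !mxE; ring.
Qed.

HB.instance Definition _ :=
  GRing.isLinear.Build C M ('M[C]_r * 'M[C]_r * 'M[C]_r)%type _
    sp_defect sp_defect_is_linear.

Definition sp : {vspace M} := lker (linfun sp_defect).

Lemma spP (X : M) :
  reflect (exists B C D : 'M_r,
             [/\ C^T = C, D^T = D & X = block_mx B C D (- B^T)])
          (X \in sp).
Proof.
rewrite memv_ker lfunE /=; apply: (iffP eqP) => [|[B [E [D [hE hD ->]]]]].
  case=> /eqP; rewrite subr_eq0 => /eqP hE /eqP; rewrite subr_eq0 => /eqP hD.
  move=> /eqP; rewrite addr_eq0 => /eqP hB.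
  exists (ulsubmx X), (ursubmx X), (dlsubmx X); split => //.
  by rewrite -hB submxK.
rewrite /sp_defect block_mxKur block_mxKdl block_mxKdr block_mxKul hE hD.
by rewrite !subrr addNr.
Qed.

Definition lie (X Y : M) : M := X *m Y - Y *m X.

Fact lie_in_sp (X Y : M) : X \in sp -> Y \in sp -> lie X Y \in sp.
Proof.
move=> /spP[B [E [D [hE hD ->]]]] /spP[B' [E' [D' [hE' hD' ->]]]].
rewrite /lie !mulmx_block opp_block_mx add_block_mx; apply/spP.
have tD (Z Z' : 'M[C]_r) : (Z + Z')^T = Z^T + Z'^T by rewrite raddfD.
have tN (Z : 'M[C]_r) : (- Z)^T = - Z^T by rewrite raddfN.
have tM (Z Z' : 'M[C]_r) : (Z *m Z')^T = Z'^T *m Z^T by rewrite trmx_mul.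
have nM (Z Z' : 'M[C]_r) : - Z *m Z' = - (Z *m Z') by rewrite mulNmx.
have Mn (Z Z' : 'M[C]_r) : Z *m - Z' = - (Z *m Z') by rewrite mulmxN.
do 3 eexists; split; last congr block_mx;
  rewrite !(tD, tN, tM, nM, Mn, trmxK, hE, hD, hE', hD');
  do 4![move: (_ *m _) => ?]; by apply/matrixP => i j; rewrite !mxE; ring.
Qed.

Definition chevalley (X : M) : M := - X^T.

Fact chevalley_is_linear : linear chevalley.
Proof. by move=> a X Y; apply/matrixP => i j; rewrite !mxE; ring. Qed.

HB.instance Definition _ :=
  GRing.isLinear.Build C M M _ chevalley chevalley_is_linear.

Definition spk : {vspace M} := (sp :&: fixedSpace (linfun chevalley))%VS.

Lemma mem_spk (X : M) : (X \in spk) = (X \in sp) && (chevalley X == X).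
Proof.
rewrite memv_cap; congr (_ && _).
by apply/fixedSpaceP/eqP; rewrite lfunE.
Qed.

Fact lie_in_spk (X Y : subvs_of spk) : lie (vsval X) (vsval Y) \in spk.
Proof.
have := subvsP X; have := subvsP Y; rewrite !mem_spk /chevalley.
case/andP=> Ysp /eqP hY /andP[Xsp /eqP hX]; rewrite lie_in_sp //=.
have tX : (vsval X)^T = - vsval X by rewrite -[in RHS]hX opprK.
have tY : (vsval Y)^T = - vsval Y by rewrite -[in RHS]hY opprK.
by rewrite /lie raddfB /= !trmx_mul tX tY !mulNmx !mulmxN !opprK opprB.
Qed.

Definition lie_spk (X Y : subvs_of spk) : subvs_of spk :=
  Subvs (lie_in_spk X Y).

Definition cartan : {vspace M} :=
  (sp :&: <<[seq delta_mx i i | i : 'I_(r + r)]>>)%VS.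

Lemma mem_cartan (X : M) : (X \in cartan) = (X \in sp) && is_diag_mx X.
Proof.
rewrite memv_cap; congr (_ && _); apply/idP/is_diag_mxP => [hX i j nij|hX].
  rewrite (coord_span hX) summxE big1 // => l _; rewrite mxE.
  set v := nth _ _ _.
  have /mapP[m _ ->] : v \in [seq delta_mx i i | i : 'I_(r + r)].
    by apply: mem_nth; rewrite (leq_trans (ltn_ord l)) // size_tuple.
  rewrite mxE; case: (eqVneq i m) => [im|]; last by rewrite mulr0.
  by case: eqP => [jm|]; [rewrite im jm eqxx in nij | rewrite mulr0].
have -> : X = \sum_i X i i *: delta_mx i i.
  apply/matrixP => i j; rewrite summxE (bigD1 i) //= !mxE eqxx /=.
  rewrite big1 => [|l /negPf li]; last by rewrite !mxE eq_sym li mulr0.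
  rewrite addr0; case: (eqVneq j i) => [->|ji]; first by rewrite mulr1.
  by rewrite mulr0; apply: hX; rewrite eq_sym.
by apply: memv_suml => i _; apply/memvZ/memv_span/map_f; rewrite mem_enum.
Qed.

Definition cartan_dual := 'Hom(subvs_of cartan, C^o).

Definition eps_fun (j : 'I_r) (H : subvs_of cartan) : C^o :=
  vsval H (lshift r j) (lshift r j).

Fact eps_fun_is_linear (j : 'I_r) : linear (eps_fun j).
Proof. by move=> a X Y; rewrite /eps_fun linearP !mxE. Qed.

HB.instance Definition _ (j : 'I_r) :=
  GRing.isLinear.Build C (subvs_of cartan) C^o _
    (eps_fun j) (eps_fun_is_linear j).

Definition eps (j : 'I_r) : cartan_dual := linfun (eps_fun j).

Fact cartan_elt_in (l : 'I_r) :
  block_mx (delta_mx l l) 0 0 (- delta_mx l l) \in cartan.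
Proof.
rewrite mem_cartan; apply/andP; split.
  apply/spP; exists (delta_mx l l), 0, 0.
  by split; rewrite ?trmx0 ?trmx_delta.
apply/is_diag_mxP => i j.
case: (split_ordP i) => i' ->; case: (split_ordP j) => j' ->.
- rewrite block_mxEul mxE; case: (eqVneq i' l) => [->|] //=.
  by case: (eqVneq j' l) => [->|] //=; rewrite eqxx.
- by rewrite block_mxEur mxE.
- by rewrite block_mxEdl mxE.
- rewrite block_mxEdr !mxE; case: (eqVneq i' l) => [->|] /=; last first.
    by rewrite oppr0.
  by case: (eqVneq j' l) => [->|] /=; [rewrite eqxx | rewrite oppr0].
Qed.

Lemma epsE (j l : 'I_r) : eps j (Subvs (cartan_elt_in l)) = (j == l)%:R.
Proof. by rewrite lfunE /= /eps_fun block_mxEul mxE andbb. Qed.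

(* insub j.+1 is None exactly when j is the last index. *)
Definition simple_root (j : 'I_r) : cartan_dual :=
  if insub j.+1 is Some l then eps j - eps l else eps j *+ 2.

Definition pos_short : {pred cartan_dual} :=
  [pred a | [exists j : 'I_r, exists l : 'I_r,
     (j < l)%N && ((a == eps j - eps l) || (a == eps j + eps l))]].

Definition pos_long : {pred cartan_dual} :=
  [pred a | [exists l : 'I_r, a == eps l *+ 2]].

Definition pos_roots : {pred cartan_dual} :=
  [predU pos_short & pos_long].

(* The value is 0 when a is not a root.  At the roots it does not depend on *)
(* the choices made by pick, see root_vec_sub, root_vec_add, root_vec_addN, *)
(* root_vec_long and root_vec_longN.                                        *)
Definition root_vec (a : cartan_dual) : M :=
  if [pick p : 'I_r * 'I_r | (p.1 != p.2) && (a == eps p.1 - eps p.2)]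
    is Some (i, j) then block_mx (delta_mx i j) 0 0 (- delta_mx j i)
  else if [pick p : 'I_r * 'I_r | (p.1 != p.2) && (a == eps p.1 + eps p.2)]
    is Some (i, j) then block_mx 0 (delta_mx i j + delta_mx j i) 0 0
  else if [pick p : 'I_r * 'I_r | (p.1 != p.2) && (a == - eps p.1 - eps p.2)]
    is Some (i, j) then block_mx 0 0 (delta_mx i j + delta_mx j i) 0
  else if [pick j : 'I_r | a == eps j *+ 2]
    is Some j then block_mx 0 (delta_mx j j) 0 0
  else if [pick j : 'I_r | a == - (eps j *+ 2)]
    is Some j then block_mx 0 0 (delta_mx j j) 0
  else 0.

Fact eps_comb_inj (a b a' b' : int) (i j i' j' : 'I_r) :
  eps i *~ a + eps j *~ b = eps i' *~ a' + eps j' *~ b' ->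
  forall l : 'I_r,
    (i == l)%:Z * a + (j == l)%:Z * b = (i' == l)%:Z * a' + (j' == l)%:Z * b'.
Proof.
move=> E l; apply: (@intr_inj C).
have evZ (f : cartan_dual) (z : int) H : (f *~ z) H = f H *~ z.
  by rewrite -scaler_int scale_lfunE -[RHS]mulrzl.
have := congr1 (fun f : cartan_dual => f (Subvs (cartan_elt_in l))) E.
by rewrite !add_lfunE !evZ !epsE !intrD !intrM !mulrzr.
Qed.

Let combB i j : eps i - eps j = eps i *~ 1 + eps j *~ (-1).
Proof. by rewrite mulrNz. Qed.
Let combD i j : eps i + eps j = eps i *~ 1 + eps j *~ 1.
Proof. by []. Qed.
Let combN i j : - eps i - eps j = eps i *~ (-1) + eps j *~ (-1).
Proof. by rewrite !mulrNz. Qed.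
Let comb2 i : eps i *+ 2 = eps i *~ 1 + eps i *~ 1.
Proof. by []. Qed.
Let combN2 i : - (eps i *+ 2) = eps i *~ (-1) + eps i *~ (-1).
Proof. by rewrite !mulrNz mulr2n opprD. Qed.

Ltac sep E i j i' j' :=
  move: (eps_comb_inj E i) (eps_comb_inj E j) (eps_comb_inj E i')
    (eps_comb_inj E j'); clear E;
  rewrite ?eqxx ?(eq_sym j i) ?(eq_sym i' i) ?(eq_sym i' j) ?(eq_sym j' i)
    ?(eq_sym j' j) ?(eq_sym j' i');
  case: (i =P j) => ?; case: (i' =P j') => ?;
  case: (i =P i') => ?; case: (i =P j') => ?; case: (j =P i') => ?;
  case: (j =P j') => ? //= *; subst.

Lemma root_vec_sub (i j : 'I_r) : i != j ->
  root_vec (eps i - eps j) = block_mx (delta_mx i j) 0 0 (- delta_mx j i).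
Proof.
move=> nij; rewrite /root_vec.
case: pickP => [[i' j'] /= /andP[n' /eqP E]|/(_ (i, j))]; last first.
  by rewrite /= nij eqxx.
by move: E nij n'; rewrite !combB => E; sep E i j i' j'.
Qed.

Lemma root_vec_add (i j : 'I_r) : i != j ->
  root_vec (eps i + eps j) = block_mx 0 (delta_mx i j + delta_mx j i) 0 0.
Proof.
move=> nij; rewrite /root_vec.
case: pickP => [[i' j'] /= /andP[n' /eqP E]|_].
  by exfalso; move: E nij n'; rewrite combB combD => E; sep E i j i' j'.
case: pickP => [[i' j'] /= /andP[n' /eqP E]|/(_ (i, j))]; last first.
  by rewrite /= nij eqxx.
by move: E nij n'; rewrite !combD => E; sep E i j i' j'; rewrite addrC.
Qed.

Lemma root_vec_addN (i j : 'I_r) : i != j ->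
  root_vec (- eps i - eps j) = block_mx 0 0 (delta_mx i j + delta_mx j i) 0.
Proof.
move=> nij; rewrite /root_vec.
case: pickP => [[i' j'] /= /andP[n' /eqP E]|_].
  by exfalso; move: E nij n'; rewrite combB combN => E; sep E i j i' j'.
case: pickP => [[i' j'] /= /andP[n' /eqP E]|_].
  by exfalso; move: E nij n'; rewrite combD combN => E; sep E i j i' j'.
case: pickP => [[i' j'] /= /andP[n' /eqP E]|/(_ (i, j))]; last first.
  by rewrite /= nij eqxx.
by move: E nij n'; rewrite !combN => E; sep E i j i' j'; rewrite addrC.
Qed.

Lemma root_vec_long (j : 'I_r) :
  root_vec (eps j *+ 2) = block_mx 0 (delta_mx j j) 0 0.
Proof.
rewrite /root_vec.
case: pickP => [[i' j'] /= /andP[n' /eqP E]|_].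
  by exfalso; move: E n'; rewrite combB comb2 => E; sep E j j i' j'.
case: pickP => [[i' j'] /= /andP[n' /eqP E]|_].
  by exfalso; move: E n'; rewrite combD comb2 => E; sep E j j i' j'.
case: pickP => [[i' j'] /= /andP[n' /eqP E]|_].
  by exfalso; move: E n'; rewrite combN comb2 => E; sep E j j i' j'.
case: pickP => [i' /= /eqP E|/(_ j)]; last by rewrite /= eqxx.
by move: E; rewrite !comb2 => E; sep E j j i' i'.
Qed.

Lemma root_vec_longN (j : 'I_r) :
  root_vec (- (eps j *+ 2)) = block_mx 0 0 (delta_mx j j) 0.
Proof.
rewrite /root_vec.
case: pickP => [[i' j'] /= /andP[n' /eqP E]|_].
  by exfalso; move: E n'; rewrite combB combN2 => E; sep E j j i' j'.
case: pickP => [[i' j'] /= /andP[n' /eqP E]|_].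
  by exfalso; move: E n'; rewrite combD combN2 => E; sep E j j i' j'.
case: pickP => [[i' j'] /= /andP[n' /eqP E]|_].
  by exfalso; move: E n'; rewrite combN combN2 => E; sep E j j i' j'.
case: pickP => [i' /= /eqP E|_].
  by exfalso; move: E; rewrite combN2 comb2 => E; sep E j j i' i'.
case: pickP => [i' /= /eqP E|/(_ j)]; last by rewrite /= eqxx.
by move: E; rewrite !combN2 => E; sep E j j i' i'.
Qed.

Lemma root_vecN (a : cartan_dual) : root_vec (- a) = (root_vec a)^T.
Proof.
rewrite {2}/root_vec.
case: pickP => [[i j] /= /andP[nij /eqP->]|n1].
  rewrite opprB root_vec_sub 1?eq_sym // tr_block_mx raddfN /=.
  by rewrite !trmx0 !trmx_delta.
case: pickP => [[i j] /= /andP[nij /eqP->]|n2].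
  rewrite opprD root_vec_addN // tr_block_mx raddfD /=.
  by rewrite !trmx0 !trmx_delta addrC.
case: pickP => [[i j] /= /andP[nij /eqP->]|n3].
  rewrite opprD !opprK root_vec_add // tr_block_mx raddfD /=.
  by rewrite !trmx0 !trmx_delta addrC.
case: pickP => [j /eqP->|n4].
  by rewrite root_vec_longN tr_block_mx !trmx0 trmx_delta.
case: pickP => [j /eqP->|n5].
  by rewrite opprK root_vec_long tr_block_mx !trmx0 trmx_delta.
rewrite trmx0 /root_vec.
case: pickP => [[i j] /= /andP[nij]|_].
  by rewrite eqr_oppLR opprB => E; have := n1 (j, i); rewrite /= eq_sym nij E.
case: pickP => [[i j] /= /andP[nij]|_].
  by rewrite eqr_oppLR opprD => E; have := n3 (i, j); rewrite /= nij E.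
case: pickP => [[i j] /= /andP[nij]|_].
  by rewrite eqr_oppLR opprD !opprK => E; have := n2 (i, j); rewrite /= nij E.
case: pickP => [j /=|_]; first by rewrite eqr_oppLR n5.
by case: pickP => [j /=|//]; rewrite eqr_oppLR opprK n4.
Qed.

Fact root_vec_in_sp (a : cartan_dual) : root_vec a \in sp.
Proof.
rewrite /root_vec.
case: pickP => [[i j] _|_].
  apply/spP; exists (delta_mx i j), 0, 0.
  by split; rewrite ?trmx0 ?trmx_delta.
case: pickP => [[i j] _|_].
  apply/spP; exists 0, (delta_mx i j + delta_mx j i), 0.
  by split; rewrite ?raddfD /= ?trmx_delta ?trmx0 ?oppr0 // addrC.
case: pickP => [[i j] _|_].
  apply/spP; exists 0, 0, (delta_mx i j + delta_mx j i).
  by split; rewrite ?raddfD /= ?trmx_delta ?trmx0 ?oppr0 // addrC.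
case: pickP => [j _|_].
  by apply/spP; exists 0, (delta_mx j j), 0; rewrite !trmx0 trmx_delta oppr0.
case: pickP => [j _|_]; last exact: mem0v.
by apply/spP; exists 0, 0, (delta_mx j j); rewrite !trmx0 trmx_delta oppr0.
Qed.

Fact root_y_in_spk (a : cartan_dual) : root_vec a - root_vec (- a) \in spk.
Proof.
rewrite mem_spk rpredB ?root_vec_in_sp //= /chevalley root_vecN raddfB /=.
by rewrite trmxK opprB.
Qed.

Definition root_y (a : cartan_dual) : subvs_of spk := Subvs (root_y_in_spk a).

Definition simple_y (j : 'I_r) : subvs_of spk := root_y (simple_root j).

Definition one_dim_rep (chi : 'Hom(subvs_of spk, C^o)) : Prop :=
  forall X Y : subvs_of spk, chi (lie_spk X Y) = 0.

Definition is_chi (t : C) (chi : 'Hom(subvs_of spk, C^o)) : Prop :=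
  [/\ one_dim_rep chi,
      forall j : 'I_r, (j.+1 < r)%N -> chi (simple_y j) = 0
    & forall j : 'I_r, j.+1 = r -> chi (simple_y j) = t].

End SymplecticLieAlgebra.

Arguments pos_short R r : clear implicits.
Arguments pos_long R r : clear implicits.
Arguments pos_roots R r : clear implicits.

(* Main.v *)
(** Write [A(B)] for the element of [k] with blocks [B, 0, 0, B] and [S(C)] for
    the one with blocks [0, C, -C, 0].  Then [y_(e_j - e_k)] is
    [A(E_jk - E_kj)], [y_(e_j + e_k)] is [S(E_jk + E_kj)] and [y_(2 e_j)] is
    [S(E_jj)], so each short [y] is, up to sign, the bracket of the other one
    with [y_(2 e_j)], while the bracket of the two short ones is
    [2 (y_(2 e_j) - y_(2 e_k))].  Hence [chi] vanishes at the short roots and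
    takes the same value at all long roots, one of which is simple. *)

Require Import Defs.
From mathcomp Require Import all_boot all_order all_algebra.
From mathcomp Require Import reals complex.

Set Implicit Arguments.
Unset Strict Implicit.
Unset Printing Implicit Defensive.

Import Order.TTheory GRing.Theory Num.Theory.

Local Open Scope ring_scope.

(** Sending [kdiag B + kanti C] to B + iC respects products. This gives the two bracket formulas
    below, with i^2 = -1 behind the reversed order in [lie_kanti]. *)
Definition kdiag (R : realType) (r : nat) (B : 'M[R[i]]_r) : 'M[R[i]]_(r + r) :=
  block_mx B 0 0 B.

Definition kanti (R : realType) (r : nat) (C : 'M[R[i]]_r) : 'M[R[i]]_(r + r) :=
  block_mx 0 C (- C) 0.

Lemma lie_kdiag_kanti (R : realType) (r : nat) (B C : 'M[R[i]]_r) :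
  lie (kdiag B) (kanti C) = kanti (B *m C - C *m B).
Proof.
rewrite /lie /kdiag /kanti !mulmx_block opp_block_mx add_block_mx.
rewrite !(mul0mx, mulmx0, mulmxN, mulNmx, oppr0, opprK, add0r, addr0).
by congr block_mx; rewrite opprB addrC.
Qed.

Lemma lie_kanti (R : realType) (r : nat) (C D : 'M[R[i]]_r) :
  lie (kanti C) (kanti D) = kdiag (D *m C - C *m D).
Proof.
rewrite /lie /kdiag /kanti !mulmx_block opp_block_mx add_block_mx.
rewrite !(mul0mx, mulmx0, mulmxN, mulNmx, oppr0, opprK, add0r, addr0).
by congr block_mx; rewrite addrC.
Qed.

Lemma root_y_sub (R : realType) (r : nat) (j k : 'I_r) : j != k ->
  vsval (root_y (eps R j - eps R k)) = kdiag (delta_mx j k - delta_mx k j).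
Proof.
move=> njk; have nkj : k != j by rewrite eq_sym.
rewrite /= opprB !root_vec_sub // /kdiag.
by rewrite opp_block_mx add_block_mx !oppr0 !addr0 opprK addrC.
Qed.

Lemma root_y_add (R : realType) (r : nat) (j k : 'I_r) : j != k ->
  vsval (root_y (eps R j + eps R k)) = kanti (delta_mx j k + delta_mx k j).
Proof.
move=> njk; rewrite /= opprD root_vec_add // root_vec_addN // /kanti.
by rewrite opp_block_mx add_block_mx !oppr0 !addr0 add0r.
Qed.

Lemma root_y_long (R : realType) (r : nat) (j : 'I_r) :
  vsval (root_y (eps R j *+ 2)) = kanti (delta_mx j j).
Proof.
rewrite /= root_vec_long root_vec_longN /kanti.
by rewrite opp_block_mx add_block_mx !oppr0 !addr0 add0r.
Qed.

(** The commutator of E_jk - E_kj with E_jj is -E_kj - E_jk. *)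
Lemma lie_sub_long (R : realType) (r : nat) (j k : 'I_r) : j != k ->
  lie_spk (root_y (eps R j - eps R k)) (root_y (eps R j *+ 2)) =
  - root_y (eps R j + eps R k).
Proof.
move=> njk; have nkj : k != j by rewrite eq_sym.
apply/val_inj.
(* The matrix under [lie_spk] is [lie] of the underlying matrices by conversion, so [congr2]
   rewrites both arguments. *)
rewrite [LHS](congr2 (@lie R r) (root_y_sub R njk) (root_y_long R j)).
rewrite [RHS](congr1 -%R (root_y_add R njk)) lie_kdiag_kanti.
rewrite mulmxBl mulmxBr !mul_delta_mx !mul_delta_mx_0 //.
by rewrite /kanti opp_block_mx !(oppr0, addr0, add0r) -opprD addrC.
Qed.

Lemma lie_long_add (R : realType) (r : nat) (j k : 'I_r) : j != k ->
  lie_spk (root_y (eps R j *+ 2)) (root_y (eps R j + eps R k)) =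
  - root_y (eps R j - eps R k).
Proof.
move=> njk; have nkj : k != j by rewrite eq_sym.
apply/val_inj.
rewrite [LHS](congr2 (@lie R r) (root_y_long R j) (root_y_add R njk)).
rewrite [RHS](congr1 -%R (root_y_sub R njk)) lie_kanti.
rewrite mulmxDl mulmxDr !mul_delta_mx !mul_delta_mx_0 //.
by rewrite /kdiag opp_block_mx !(oppr0, addr0, add0r) opprB.
Qed.

(** The products of E_jk - E_kj and E_jk + E_kj in the two orders are E_jj - E_kk and its negative,
    whence the factor 2. *)
Lemma lie_sub_add (R : realType) (r : nat) (j k : 'I_r) : j != k ->
  lie_spk (root_y (eps R j - eps R k)) (root_y (eps R j + eps R k)) =
  (root_y (eps R j *+ 2) - root_y (eps R k *+ 2)) *+ 2.
Proof.
move=> njk; have nkj : k != j by rewrite eq_sym.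
apply/val_inj.
rewrite [LHS](congr2 (@lie R r) (root_y_sub R njk) (root_y_add R njk)).
have -> : val ((root_y (eps R j *+ 2) - root_y (eps R k *+ 2)) *+ 2) =
          (kanti (delta_mx j j) - kanti (delta_mx k k)) *+ 2.
  by rewrite -!root_y_long.
rewrite lie_kdiag_kanti !(mulmxDl, mulmxDr, mulmxN, mulNmx) !mul_delta_mx.
rewrite !mul_delta_mx_0 // oppr0 !addr0 !add0r.
rewrite /kanti mulr2n opp_block_mx !add_block_mx !oppr0 !addr0.
rewrite !(opprD, opprK) [- delta_mx k k + _]addrC.
by rewrite [delta_mx k k - _]addrC.
Qed.

Lemma one_dim_rep_add (R : realType) (r : nat)
    (chi : 'Hom(subvs_of (spk R r), R[i]^o)) (j k : 'I_r) :
  one_dim_rep chi -> j != k -> chi (root_y (eps R j + eps R k)) = 0.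
Proof.
move=> chi0 njk; apply/eqP; rewrite -oppr_eq0 -linearN /=.
by rewrite -(lie_sub_long R njk) chi0.
Qed.

Lemma one_dim_rep_sub (R : realType) (r : nat)
    (chi : 'Hom(subvs_of (spk R r), R[i]^o)) (j k : 'I_r) :
  one_dim_rep chi -> j != k -> chi (root_y (eps R j - eps R k)) = 0.
Proof.
move=> chi0 njk; apply/eqP; rewrite -oppr_eq0 -linearN /=.
by rewrite -(lie_long_add R njk) chi0.
Qed.

Lemma one_dim_rep_long (R : realType) (r : nat)
    (chi : 'Hom(subvs_of (spk R r), R[i]^o)) (j k : 'I_r) :
  one_dim_rep chi -> chi (root_y (eps R j *+ 2)) = chi (root_y (eps R k *+ 2)).
Proof.
move=> chi0; have [->//|njk] := eqVneq j k.
have := chi0 (root_y (eps R j - eps R k)) (root_y (eps R j + eps R k)).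
rewrite (lie_sub_add R njk) linearMn linearB /= => /eqP.
(* The factor 2 cancels in characteristic zero. *)
by rewrite mulrn_eq0 /= subr_eq0 => /eqP.
Qed.

Theorem lemma4p3 (R : realType) (r : nat) (hr : (1 <= r)%N) (t : R[i])
    (chi : 'Hom(subvs_of (spk R r), R[i]^o)) (hchi : is_chi t chi)
    (alpha : cartan_dual R r) (halpha : alpha \in pos_roots R r) :
  (alpha \in pos_short R r -> chi (root_y alpha) = 0) /\
  (alpha \in pos_long R r -> chi (root_y alpha) = t).
Proof.
case: hchi => chi0 _ chit; split.
  case/existsP=> j /existsP[k /andP[ltjk]].
  have njk : j != k by rewrite neq_ltn ltjk.
  by case/orP=> /eqP->; [exact: one_dim_rep_sub | exact: one_dim_rep_add].
case/existsP=> k /eqP->.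
(* Indices are 0-based, so the long simple root sits at [r.-1], an index because r is positive. *)
have lt_last : (r.-1 < r)%N by rewrite prednK.
pose m := Ordinal lt_last.
have m_last : m.+1 = r by rewrite /= prednK.
rewrite (one_dim_rep_long k m chi0) -(chit m m_last) /simple_y /simple_root.
(* No index follows [m], so [insub] gives [None] and [simple_root m] is twice [eps R m]. *)
by rewrite insubF // m_last ltnn.
Qed.
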